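(* (i) The inverse function of $\widetilde\mu$ with respect to the convolution $*$ on $F_{\mathcal{OP}^2}$ is $\widetilde\zeta$. (ii) For real sequences $\underline s=(s_1,s_2,\dots)$ and $\underline t=(t_1,t_2,\dots)$, $\gamma_{\underline s}\mathbin{\triangle}\beta_{\underline t}=\beta_{\underline s\circ\underline t}$, where $\underline s\circ\underline t=(s_1t_1,s_2t_2,\dots)$. (iii) $\beta_t$ satisfies the semigroup property $\beta_s*\beta_t=\beta_{st}$ for $s,t\in\mathbb R$.
   Context: $\mathbb N=\{1,2,\dots\}$, $[n]=\{1,\dots,n\}$. An ordered set partition of $[n]$ is a sequence $\pi=(P_1,\dots,P_p)$ of pairwise disjoint nonempty blocks with union $[n]$; $|\pi|=p$; $\mathcal{OP}_n$ is the set of them; $\bar\pi$ is the underlying set partition; set partitions are ordered by refinement. For $\pi=(P_1,\dots,P_p)$, $\sigma=(S_1,\dots,S_s)$ we write $\pi\le\sigma$ iff $\bar\pi\le\bar\sigma$ and, whenever $i<j$, $P_i\subseteq S_k$, $P_j\subseteq S_l$, one has $k\le l$. $F_{\mathcal{OP}^m}$ is the set of $\mathbb C$-valued functions on $m$-chains $\sigma_1\le\cdots\le\sigma_m$ in $\mathcal{OP}_n$, $n$ ranging over $\mathbb N$. For $f,g\in F_{\mathcal{OP}^2}$, $(f*g)(\sigma,\pi)=\sum_{\sigma\le\rho\le\pi}f(\sigma,\rho)g(\rho,\pi)$, with unit $\delta(\sigma,\pi)=1$ if $\sigma=\pi$ and $0$ otherwise; for $f\in F_{\mathcal{OP}^3}$,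 $g\in F_{\mathcal{OP}^2}$, $(f\mathbin{\triangle} g)(\sigma,\pi)=\sum_{\sigma\le\rho\le\pi}f(\sigma,\rho,\pi)g(\rho,\pi)$. For $\sigma\le\rho\le\pi=(P_1,\dots,P_p)$ and $P$ a block of $\rho$ or $\pi$, let $\#(\sigma\rfloor_P)$ be the number of blocks of $\sigma$ contained in $P$. Define (generalized binomial coefficients, $\underline t$ a real sequence, $t\in\mathbb R$) $$\widetilde\zeta(\sigma,\pi)=\frac1{\prod_{P\in\pi}\#(\sigma\rfloor_P)!},\qquad\widetilde\mu(\sigma,\pi)=\frac{(-1)^{|\sigma|-|\pi|}}{\prod_{P\in\pi}\#(\sigma\rfloor_P)},$$ $$\beta_{\underline t}(\sigma,\pi)=\prod_{i=1}^p\binom{t_i}{\#(\sigma\rfloor_{P_i})},\qquad\beta_t=\beta_{(t,t,\dots)},\qquad\gamma_{\underline t}(\sigma,\rho,\pi)=\prod_{i=1}^p\prod_{R\in\rho,\,R\subseteq P_i}\binom{t_i}{\#(\sigma\rfloor_R)}.$$ *)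

(* Defs.v *)
From HB Require Import structures.
From mathcomp Require Import all_boot all_order all_algebra.
From mathcomp Require Import complex.
From mathcomp Require Import reals.

Set Implicit Arguments.
Unset Strict Implicit.
Unset Printing Implicit Defensive.

Import GRing.Theory.

Local Open Scope ring_scope.
Local Open Scope complex_scope.

Section OrderedSetPartitions.

Variable n : nat.

(* Here 'I_n = {0, ..., n - 1} plays the part of [n] = {1, ..., n}, and the
   blocks P_1, ..., P_p are numbered 0, ..., p - 1. *)
Definition is_osp (s : seq {set 'I_n}) : bool :=
  [&& all (fun P => P != set0) s,
      pairwise (fun P Q : {set 'I_n} => [disjoint P & Q]) s &
      \bigcup_(P <- s) P == setT].

Record OP := Osp { blocks :> seq {set 'I_n}; _ : is_osp blocks }.

HB.instance Definition _ := [isSub for blocks].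
HB.instance Definition _ := [Countable of OP by <:].

Lemma size_osp (p : OP) : (size p <= n)%N.
Proof.
case: p => s /= /and3P[nz dj _].
rewrite -[leqRHS]card_ord; apply: leq_trans (max_card (\bigcup_(P <- s) P)).
elim: s nz dj => [|P s IHs] //= /andP[Pnz nz] /andP[dP dj].
have dPs : [disjoint P & \bigcup_(Q <- s) Q].
  elim: s {IHs nz dj} dP => [|Q s IHs] /=; first by rewrite big_nil -setI_eq0 setI0.
  move=> /andP[dPQ /IHs dPs]; rewrite big_cons.
  by rewrite -setI_eq0 setIUr setU_eq0 !setI_eq0 dPQ.
rewrite big_cons cardsU disjoint_setI0 // cards0 subn0 -add1n.
by apply: leq_add; [rewrite card_gt0 | apply: IHs].
Qed.

Definition bseq_osp (p : OP) : n.-bseq {set 'I_n} := Bseq (size_osp p).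
Definition osp_bseq (b : n.-bseq {set 'I_n}) : option OP := insub (bseqval b).

Lemma bseq_ospK : pcancel bseq_osp osp_bseq.
Proof. by move=> p; apply: valK. Qed.

HB.instance Definition _ : isFinite OP := PCanIsFinite bseq_ospK.

Definition unordered (p : OP) : {set {set 'I_n}} := [set P in blocks p].

Definition refines (A B : {set {set 'I_n}}) : bool :=
  [forall P in A, exists Q in B, P \subset Q].

Definition block (p : OP) (i : 'I_(size p)) : {set 'I_n} := nth set0 p i.

Definition ople (p s : OP) : bool :=
  refines (unordered p) (unordered s) &&
  [forall i : 'I_(size p), forall j : 'I_(size p),
   forall k : 'I_(size s), forall l : 'I_(size s),
   [&& (i < j)%N, block i \subset block k & block j \subset block l]
     ==> (k <= l)%N].

Definition nblocks_in (s : OP) (P : {set 'I_n}) : nat :=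
  count (fun B : {set 'I_n} => B \subset P) s.

Record interval (s p : OP) :=
  Interval { ival :> OP; _ : ople s ival && ople ival p }.

HB.instance Definition _ s p := [isSub for @ival s p].
HB.instance Definition _ s p := [Finite of interval s p by <:].

Lemma interval_l (s p : OP) (r : interval s p) : ople s r.
Proof. by case: r => r /= /andP[]. Qed.

Lemma interval_r (s p : OP) (r : interval s p) : ople r p.
Proof. by case: r => r /= /andP[]. Qed.

End OrderedSetPartitions.

Section ChainFunctions.

Variable R : realType.

(* Functions on 2- and 3-chains of OP_m for all m >= 1, written m = n.+1. *)
Definition F2 := forall (n : nat) (s p : OP n.+1), ople s p -> R[i].

Definition F3 :=
  forall (n : nat) (s r p : OP n.+1), ople s r -> ople r p -> R[i].

Definition conv (f g : F2) : F2 := fun n s p _ =>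
  \sum_(r : interval s p) f n s r (interval_l r) * g n r p (interval_r r).

Definition triangle (f : F3) (g : F2) : F2 := fun n s p _ =>
  \sum_(r : interval s p)
     f n s r p (interval_l r) (interval_r r) * g n r p (interval_r r).

Definition delta : F2 := fun n s p _ => (s == p)%:R.

Definition zeta : F2 := fun n s p _ =>
  (\prod_(P <- blocks p) (nblocks_in s P)`!%:R)^-1.

(* The truncated subtraction is exact: s <= p forces size p <= size s. *)
Definition mu : F2 := fun n s p _ =>
  (-1) ^+ (size s - size p) / \prod_(P <- blocks p) (nblocks_in s P)%:R.

Definition binr (x : R) (k : nat) : R :=
  (\prod_(i < k) (x - i%:R)) / k`!%:R.

(* A real sequence (t_1, t_2, ...) is encoded as i |-> t_(i+1), in accordance
   with the numbering of blocks from 0. *)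
Definition beta (t : nat -> R) : F2 := fun n s p _ =>
  \prod_(i < size p) (binr (t i) (nblocks_in s (block i)))%:C.

Definition beta_const (t : R) : F2 := beta (fun=> t).

Definition gamma (t : nat -> R) : F3 := fun n s r p _ _ =>
  \prod_(i < size p) \prod_(B <- blocks r | B \subset block i)
     (binr (t i) (nblocks_in s B))%:C.

End ChainFunctions.

Arguments delta {R}.
Arguments zeta {R}.
Arguments mu {R}.

(* Main.v *)
Require Import Defs.
From mathcomp Require Import all_boot all_order all_algebra.
From mathcomp Require Import complex.
From mathcomp Require Import boolp reals.

Set Implicit Arguments.
Unset Strict Implicit.
Unset Printing Implicit Defensive.

Import GRing.Theory Num.Theory.
Local Open Scope ring_scope.

(** All the functions involved are products over blocks of quantities that
depend only on numbers of subblocks, so everything reduces to sums over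
compositions of integers.

If [s] is at most [p], then each block of [p] is the union of a run of
consecutive blocks of [s], and [s] is the concatenation of these runs
([ople_flatten]).  An intermediate [r] cuts each run further into shorter runs;
recording the lengths of the latter identifies the interval from [s] to [p] with
the product, over the blocks [P] of [p], of the sets of compositions of the
number of blocks of [s] inside [P] ([perm_profiles]).  A convolution of
multiplicative functions thus factors over the blocks of [p]
([interval_sum]), with factors
<<
  composition_sum a b k =
    \sum_(c_1 + ... + c_m = k) a c_1 * ... * a c_m * b m,
>>
which is the coefficient of [X^k] in the composite series B(A(X)), where
A(X) is the sum of the [a j * X^j] for [j > 0] and B(X) that of the [b m * X^m]
([composition_sum_coef]).

It remains to evaluate three composites of power series.

- Binomial coefficients correspond to ((1 + X)^s - 1, (1 + X)^t), whose
  composite is (1 + X)^(s t).  For natural [s] and [t] this is an identity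
  between polynomials; since both sides are polynomial in [s] and in [t], it
  extends to all values ([composition_sum_gbin]).  This gives the
  identity between [gamma] and [beta].  The semigroup property is the case of
  constant sequences, because then the factor of [gamma] attached to a block of
  [r] no longer depends on the block of [p] around it.

- The functions [mu] and [zeta] correspond to log(1 + X) and exp X - 1, which are
  limits of the binomial series: ((1 + X)^x - 1) / x tends to the former and
  (1 + x X)^(1/x) to exp X as [x] tends to 0.  The limit can be taken
  algebraically: suitably rescaled, the coefficients of both are polynomials in
  [x], the binomial identity with [s * t = x * x^-1 = 1] is an identity between
  such polynomials at all positive integers [x], hence it also holds at
  [x = 0] ([composition_sum_log_exp], [composition_sum_exp_log]). *)

(** * Compositions of integers *)

Fixpoint fixed_size_compositions (m k : nat) : seq (seq nat) :=
  if m is m'.+1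
  then [seq c :: cs | c <- iota 1 k, cs <- fixed_size_compositions m' (k - c)]
  else if k == 0%N then [:: [::]] else [::].

Definition compositions (k : nat) : seq (seq nat) :=
  [seq c | m <- iota 0 k.+1, c <- fixed_size_compositions m k].

Lemma mem_fixed_size_compositions m k c :
  (c \in fixed_size_compositions m k) =
  [&& size c == m, 0%N \notin c & sumn c == k].
Proof.
elim: m k c => [|m IHm] k c /=.
  by case: c => [|x c]; case: k.
apply/allpairsPdep/idP => [[x [cs [+ + ->]]] /=|].
  rewrite mem_iota add1n ltnS IHm in_cons eqSS => /andP[x1 xk].
  by case/and3P=> -> cs0 /eqP ->; rewrite negb_or neq_ltn x1 cs0 subnKC /=.
case: c => [|x c] //=; rewrite in_cons eqSS negb_or (eq_sym 0%N) -lt0n.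
case/and3P=> szc /andP[x0 c0] /eqP <-; exists x, c.
by rewrite mem_iota x0 IHm szc c0 addKn add1n ltnS leq_addr eqxx.
Qed.

Lemma size_le_sumn c : 0%N \notin c -> (size c <= sumn c)%N.
Proof.
elim: c => //= x c IHc; rewrite in_cons negb_or => /andP[x0 /IHc sc].
by rewrite -add1n leq_add // lt0n eq_sym.
Qed.

Lemma mem_compositions k c :
  (c \in compositions k) = (0%N \notin c) && (sumn c == k).
Proof.
apply/allpairsPdep/andP => [[m [c' [_ + ->]]]|[c0 /eqP sc]].
  by rewrite mem_fixed_size_compositions => /and3P[].
exists (size c), c; rewrite mem_fixed_size_compositions c0 sc !eqxx mem_iota.
by rewrite add0n ltnS -sc size_le_sumn.
Qed.

Lemma uniq_fixed_size_compositions m k : uniq (fixed_size_compositions m k).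
Proof.
elim: m k => [|m IHm] k /=; first by case: eqP.
apply: allpairs_uniq_dep => [|x _|]; rewrite ?iota_uniq //.
by move=> [x c] [y d] _ _ /= [-> ->].
Qed.

Lemma uniq_compositions k : uniq (compositions k).
Proof.
apply: allpairs_uniq_dep => [|x _|].
- exact: iota_uniq.
- exact: uniq_fixed_size_compositions.
move=> _ _ /allpairsPdep[m [c [_ + ->]]] /allpairsPdep[l [d [_ + ->]]] /=.
rewrite !mem_fixed_size_compositions => /and3P[/eqP <- _ _] /and3P[/eqP <- _ _].
by move=> ->.
Qed.

Section CompositionSums.
Variable K : comNzRingType.
Implicit Types (a b : nat -> K) (A B : {poly K}).

(** Composition of power series at the level of coefficient sequences (Faa di
Bruno's formula for ordinary generating functions). *)
Definition composition_sum a b k : K :=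
  \sum_(c <- compositions k) (\prod_(j <- c) a j) * b (size c).

(** Parts of a composition are positive, and so is the number of parts of a
composition of [k > 0], so the values of [a] and [b] at 0 do not matter. *)
Lemma eq_composition_sum a a' b b' k : (0 < k)%N ->
  (forall j, (0 < j)%N -> a j = a' j) -> (forall m, (0 < m)%N -> b m = b' m) ->
  composition_sum a b k = composition_sum a' b' k.
Proof.
move=> k0 eq_a eq_b; apply: eq_big_seq => c.
rewrite mem_compositions => /andP[c0 /eqP sc]; congr (_ * _).
  apply: eq_big_seq => j jc; apply: eq_a.
  by rewrite lt0n; apply: contraNneq c0 => <-.
by apply: eq_b; case: c sc {c0} => //= k_0; rewrite -k_0 in k0.
Qed.

Lemma coef_exp_compositions A m k : A`_0 = 0 ->
  (A ^+ m)`_k = \sum_(c <- fixed_size_compositions m k) \prod_(j <- c) A`_j.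
Proof.
move=> A0; elim: m k => [|m IHm] k /=.
  rewrite expr0 coef1; case: eqP => _; last by rewrite big_nil.
  by rewrite big_seq1 big_nil.
rewrite big_allpairs_dep /= exprS coefM.
rewrite -(big_mkord xpredT (fun j => A`_j * (A ^+ m)`_(k - j))).
rewrite /index_iota subn0 /= big_cons A0 mul0r add0r.
apply: eq_bigr => j _; rewrite IHm big_distrr /=.
by apply: eq_bigr => c _; rewrite big_cons.
Qed.

(** Expanding B(A(X)) gives the sum of the [B`_m *: A ^+ m].  Only [m <= k]
contribute to the coefficient of [X^k], because A has no constant term. *)
Lemma composition_sum_coef A B k : A`_0 = 0 ->
  composition_sum (fun j => A`_j) (fun m => B`_m) k = (B \Po A)`_k.
Proof.
move=> A0; rewrite coef_comp_poly /composition_sum big_allpairs_dep /=.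
pose F m := B`_m * (A ^+ m)`_k.
rewrite (eq_bigr F) => [|m _]; last first.
  rewrite /F coef_exp_compositions // big_distrr; apply: eq_big_seq => c /=.
  by rewrite mem_fixed_size_compositions => /andP[/eqP <- _]; rewrite mulrC.
have widen l N : (l <= N)%N -> (forall i, (l <= i)%N -> F i = 0) ->
    \sum_(i < l) F i = \sum_(i < N) F i.
  move=> leN F0; rewrite (big_ord_widen N) // big_mkcond; apply: eq_bigr => i _.
  by case: ltnP => // /F0.
(* Both sums extend to a common range by terms that vanish. *)
rewrite -[LHS]/(\sum_(m <- index_iota 0 k.+1) F m) big_mkord.
rewrite (widen _ (maxn k.+1 (size B))) ?leq_maxl // => [|m ltkm]; last first.
  rewrite /F coef_exp_compositions // big1_seq ?mulr0 // => c /=.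
  rewrite mem_fixed_size_compositions => /and3P[/eqP szc c0 /eqP sc].
  suff: (size c <= sumn c)%N by rewrite szc sc leqNgt ltkm.
  exact: size_le_sumn.
by rewrite -(widen (size B)) ?leq_maxr // => m leBm; rewrite /F nth_default ?mul0r.
Qed.

End CompositionSums.

Lemma rmorph_composition_sum (K L : comNzRingType) (h : {rmorphism K -> L})
    (a b : nat -> K) k :
  h (composition_sum a b k) = composition_sum (h \o a) (h \o b) k.
Proof.
rewrite rmorph_sum; apply: eq_bigr => c _.
by rewrite rmorphM rmorph_prod.
Qed.

(** Substituting [x * A(X)] into B(X) is substituting A(X) into B(x X). *)
Lemma composition_sum_dilate_outer (K : comNzRingType) (a b : nat -> K) x k :
  composition_sum (fun j => x * a j) b k =
  composition_sum a (fun m => x ^+ m * b m) k.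
Proof.
apply: eq_bigr => c _; rewrite big_split /= big_const_seq count_predT.
by rewrite iter_mulr_1 mulrCA -mulrA mulrCA.
Qed.

(** The composite of A(x X) and B(X) is (B o A)(x X). *)
Lemma composition_sum_dilate_inner (K : comNzRingType) (a b : nat -> K) x k :
  composition_sum (fun j => x ^+ j * a j) b k = x ^+ k * composition_sum a b k.
Proof.
rewrite big_distrr; apply: eq_big_seq => c /=.
rewrite mem_compositions => /andP[_ /eqP <-].
rewrite big_split /= -mulrA; congr (_ * _).
by rewrite sumnE -(big_morph _ (exprD x) (expr0 x)).
Qed.

(** * Binomial, logarithm and exponential series *)

Section GeneralizedBinomials.
Variable F : numFieldType.
Implicit Types (x s t : F) (p q : {poly F}).

(** Avoiding 0 lets this principle apply to identities whose proof divides by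
the indeterminate. *)
Lemma poly_eq_on_pos_nat p q :
  (forall n, p.[n.+1%:R] = q.[n.+1%:R]) -> p = q.
Proof.
move=> pq; apply/eqP; rewrite -subr_eq0; apply/eqP.
pose rs : seq F := [seq n.+1%:R | n <- iota 0 (size (p - q))].
apply: (@roots_geq_poly_eq0 _ _ rs).
- apply/allP => _ /mapP[n _ ->].
  by rewrite rootE hornerD hornerN pq subrr.
- rewrite map_inj_uniq ?iota_uniq // => m n /eqP.
  by rewrite eqr_nat => /eqP[].
- by rewrite size_map size_iota.
Qed.

Definition gbin x k : F := (\prod_(i < k) (x - i%:R)) / k`!%:R.

Lemma fact_neq0 k : k`!%:R != 0 :> F.
Proof. by rewrite pnatr_eq0 -lt0n fact_gt0. Qed.

Lemma gbin_nat n k : gbin n%:R k = 'C(n, k)%:R.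
Proof.
apply: (mulIf (fact_neq0 k)); rewrite -natrM bin_ffact divfK ?fact_neq0 //.
elim: k => [|k IHk]; first by rewrite big_ord0.
rewrite big_ord_recr /= IHk ffactnSr natrM.
have [lekn|ltnk] := leqP k n; first by rewrite natrB.
by rewrite ffact_small ?mul0r.
Qed.

Definition gbin_poly k : {poly F} :=
  (k`!%:R)^-1 *: \prod_(i < k) ('X - i%:R%:P).

Lemma horner_gbin_poly k x : (gbin_poly k).[x] = gbin x k.
Proof.
rewrite hornerZ horner_prod mulrC; congr (_ * _).
by apply: eq_bigr => i _; rewrite hornerXsubC.
Qed.

Lemma coef_binomial_series n j : (('X + 1 : {poly F}) ^+ n)`_j = 'C(n, j)%:R.
Proof.
rewrite exprD1n; under eq_bigr do rewrite -scaler_nat.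
rewrite -(poly_def n.+1 (fun i => 'C(n, i)%:R : F)) coef_poly.
by case: ltnP => // /bin_small ->.
Qed.

Lemma horner_gbin_dilate k c x : (gbin_poly k \Po (c *: 'X)).[x] = gbin (c * x) k.
Proof. by rewrite horner_comp horner_gbin_poly hornerZ hornerX. Qed.

(** The composite of (1 + X)^m - 1 and (1 + X)^n is (1 + X)^(m n), an identity
between polynomials. *)
Lemma composition_sum_bin (m n k : nat) : (0 < k)%N ->
  composition_sum (gbin m%:R) (gbin n%:R) k = gbin (m * n)%:R k.
Proof.
move=> k0; pose A : {poly F} := ('X + 1) ^+ m - 1.
have A0 : A`_0 = 0 by rewrite coefB coef_binomial_series coef1 bin0 subrr.
rewrite (@eq_composition_sum _ _ (fun j => A`_j) _
           (fun l => (('X + 1 : {poly F}) ^+ n)`_l)) //; first last.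
- by move=> l _; rewrite coef_binomial_series gbin_nat.
- move=> j j0; rewrite coefB coef_binomial_series coef1 gbin_nat.
  by rewrite gtn_eqF // subr0.
rewrite composition_sum_coef // rmorphXn rmorphD rmorph1 /= comp_polyX subrK.
by rewrite -exprM coef_binomial_series gbin_nat.
Qed.

Lemma horner_composition_sum (a b : nat -> {poly F}) x k :
  (composition_sum a b k).[x] =
  composition_sum (fun j => (a j).[x]) (fun m => (b m).[x]) k.
Proof. exact: (rmorph_composition_sum (horner_eval x)). Qed.

(** Both sides are polynomial in [s] and in [t], so the case of naturals extends
first to every [s] with [t] natural, then to every [t]. *)
Lemma composition_sum_gbin s t k : (0 < k)%N ->
  composition_sum (gbin s) (gbin t) k = gbin (s * t) k.
Proof.
move=> k0.
have nat_outer n : composition_sum (gbin s) (gbin n%:R) k = gbin (s * n%:R) k.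
  pose lhs := composition_sum gbin_poly (fun m => (gbin n%:R m)%:P) k.
  pose rhs := gbin_poly k \Po (n%:R *: 'X).
  suff: lhs.[s] = rhs.[s].
    rewrite horner_composition_sum horner_gbin_dilate.
    rewrite mulrC => <-; apply: eq_composition_sum => // j _.
      by rewrite horner_gbin_poly.
    by rewrite hornerC.
  congr _.[s]; apply: poly_eq_on_pos_nat => m.
  rewrite horner_composition_sum horner_gbin_dilate.
  rewrite mulrC -natrM -composition_sum_bin //.
  apply: eq_composition_sum => // j _; first by rewrite horner_gbin_poly.
  by rewrite hornerC.
pose lhs := composition_sum (fun j => (gbin s j)%:P) gbin_poly k.
pose rhs := gbin_poly k \Po (s *: 'X).
suff: lhs.[t] = rhs.[t].
  rewrite horner_composition_sum horner_gbin_dilate.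
  move=> <-; apply: eq_composition_sum => // j _; first by rewrite hornerC.
  by rewrite horner_gbin_poly.
congr _.[t]; apply: poly_eq_on_pos_nat => n.
rewrite horner_composition_sum horner_gbin_dilate.
rewrite -nat_outer; apply: eq_composition_sum => // j _; first by rewrite hornerC.
by rewrite horner_gbin_poly.
Qed.

Lemma gbin1 k : (0 < k)%N -> gbin 1 k = (k == 1%N)%:R.
Proof.
by case: k => [|[|k]] // _; rewrite (gbin_nat 1) ?bin1 // bin_small.
Qed.

(** The coefficients of log(1 + X) and of exp X. *)
Definition log_coef c : F := (-1) ^+ c.-1 / c%:R.
Definition exp_coef m : F := (m`!%:R)^-1.

(** The coefficient of [X^c] in ((1 + X)^x - 1) / x, as a polynomial in [x]: the
factor [x - 0] of the binomial coefficient is dropped. *)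
Definition log_poly c : {poly F} :=
  (c`!%:R)^-1 *: \prod_(1 <= i < c) ('X - i%:R%:P).

(** The coefficient of [X^m] in (1 + x X)^(1/x), as a polynomial in [x]. *)
Definition exp_poly m : {poly F} :=
  (m`!%:R)^-1 *: \prod_(i < m) (1 - i%:R *: 'X).

Lemma horner_log_poly c x : (0 < c)%N -> x * (log_poly c).[x] = gbin x c.
Proof.
case: c => // c _; rewrite hornerZ horner_prod /gbin mulrCA mulrC; congr (_ / _).
rewrite big_add1 big_mkord big_ord_recl mulr0n subr0 /=; congr (_ * _).
by apply: eq_bigr => i _; rewrite hornerXsubC.
Qed.

Lemma horner_exp_poly m x : x != 0 -> (exp_poly m).[x] = x ^+ m * gbin x^-1 m.
Proof.
move=> x0; rewrite hornerZ horner_prod /gbin mulrC mulrA; congr (_ / _).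
rewrite -[m in x ^+ m]card_ord -prodr_const -big_split /=.
apply: eq_bigr => i _; rewrite !hornerE /= mulrBr divff //.
by rewrite mulrC.
Qed.

Lemma horner_log_poly0 c : (0 < c)%N -> (log_poly c).[0] = log_coef c.
Proof.
case: c => // c _; rewrite hornerZ horner_prod big_add1 big_mkord /=.
under eq_bigr do rewrite hornerXsubC sub0r -mulN1r.
rewrite big_split /= prodr_const card_ord -natr_prod.
have -> : (\prod_(i < c) i.+1 = c`!)%N by rewrite fact_prod big_add1 big_mkord.
by rewrite /log_coef factS natrM mulrCA invfM -mulrA mulVf ?mulr1 ?fact_neq0.
Qed.

Lemma horner_exp_poly0 m : (exp_poly m).[0] = exp_coef m.
Proof.
rewrite hornerZ horner_prod big1 ?mulr1 // => i _.
by rewrite !hornerE subr0.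
Qed.

(** exp(log(1 + X)) = 1 + X, obtained from ((1 + X)^x)^(1/x) = 1 + X at
[x = 0]. *)
Lemma composition_sum_log_exp k : (0 < k)%N ->
  composition_sum log_coef exp_coef k = (k == 1%N)%:R.
Proof.
move=> k0; pose p := composition_sum log_poly exp_poly k.
have -> : composition_sum log_coef exp_coef k = p.[0].
  rewrite horner_composition_sum; apply: eq_composition_sum => // j j0.
    by rewrite horner_log_poly0.
  by rewrite horner_exp_poly0.
suff -> : p = (k == 1%N)%:R%:P by rewrite hornerC.
apply: poly_eq_on_pos_nat => n; set x : F := n.+1%:R.
have x0 : x != 0 by rewrite pnatr_eq0.
rewrite hornerC -gbin1 // -[1](divff x0) -composition_sum_gbin //.
rewrite horner_composition_sum.
under [X in composition_sum _ X]eq_fun do rewrite horner_exp_poly //.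
rewrite -composition_sum_dilate_outer; apply: eq_composition_sum => // j j0.
by rewrite horner_log_poly.
Qed.

(** log(exp X) = X, obtained from ((1 + x X)^(1/x))^x = 1 + x X: after subtracting
1 and dividing by [x], both sides are polynomial in [x]. *)
Lemma composition_sum_exp_log k : (0 < k)%N ->
  composition_sum exp_coef log_coef k = (k == 1%N)%:R.
Proof.
move=> k0; pose p := composition_sum exp_poly log_poly k.
have -> : composition_sum exp_coef log_coef k = p.[0].
  rewrite horner_composition_sum; apply: eq_composition_sum => // j j0.
    by rewrite horner_exp_poly0.
  by rewrite horner_log_poly0.
suff -> : p = (k == 1%N)%:R *: 'X^(k.-1).
  rewrite hornerZ hornerXn.
  by case: k k0 {p} => [|[|k]] //= _; rewrite ?mulr1 ?mul0r.
(* [log_poly] lacks a factor [x] of the binomial coefficient: restore it. *)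
apply: (mulfI (negbT (polyX_eq0 F))).
apply: poly_eq_on_pos_nat => n; set x : F := n.+1%:R.
have x0 : x != 0 by rewrite pnatr_eq0.
rewrite -scalerAr -exprS prednK // hornerZ hornerXn hornerM hornerX.
rewrite -gbin1 // -[1](divff x0) [x / x]mulrC -composition_sum_gbin // [RHS]mulrC.
rewrite -composition_sum_dilate_inner horner_composition_sum.
rewrite big_distrr; apply: eq_big_seq => c /=.
rewrite mem_compositions => /andP[c0 /eqP sc].
rewrite mulrCA horner_log_poly; last first.
  by case: c sc {c0} => //= k_0; rewrite -k_0 in k0.
by congr (_ * _); apply: eq_bigr => j _; rewrite horner_exp_poly.
Qed.

End GeneralizedBinomials.

(** * The order on ordered set partitions *)

(** Sorting into buckets moves nothing when the key is already nondecreasing. *)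
Lemma flatten_fibers (T : eqType) (f : T -> nat) (s : seq T) m :
  pairwise (fun x y => f x <= f y)%N s -> all (fun x => f x < m)%N s ->
  flatten [seq [seq x <- s | f x == k] | k <- iota 0 m] = s.
Proof.
elim: s => [|x s IHs] /=.
  by move=> _ _; elim: (iota 0 m).
case/andP=> fx_le /IHs{}IHs /andP[fx_m /IHs{}IHs].
have iotaE : iota 0 m = iota 0 (f x) ++ f x :: iota (f x).+1 (m - (f x).+1).
  rewrite -[m in LHS](subnKC fx_m) addSnnS iotaD //=.
have low k : k \in iota 0 (f x) -> [seq y <- s | f y == k] = [::].
  rewrite mem_iota => /andP[_ k_lt]; apply/eqP; rewrite -[_ == _]negbK -has_filter.
  rewrite -all_predC; apply: sub_all fx_le => y /= fxy.
  by rewrite gtn_eqF // (leq_trans _ fxy).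
rewrite -[in RHS]IHs iotaE !map_cat !flatten_cat /= eqxx.
have nil1 t : {in iota 0 (f x), forall k, t k = [::]} ->
  flatten [seq t k | k <- iota 0 (f x)] = [::] :> seq T.
  elim: (iota 0 (f x)) => //= k l IHl tl; rewrite tl ?mem_head //= IHl // => i il.
  by apply: tl; rewrite in_cons il orbT.
rewrite !nil1 //=; last first.
  by move=> k k_low; rewrite low // gtn_eqF //; move: k_low; rewrite mem_iota.
congr (_ :: _ ++ flatten _); apply/eq_in_map => k; rewrite mem_iota => /andP[k_gt _].
by rewrite (ltn_eqF k_gt).
Qed.

Section OrderedPartitions.
Variable n : nat.
Implicit Types (s r p : seq {set 'I_n}) (B P Q : {set 'I_n}).
Implicit Types (ss rr : seq (seq {set 'I_n})).

Definition restrict s Q := [seq B : {set 'I_n} <- s | B \subset Q].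
Definition union s : {set 'I_n} := \bigcup_(B <- s) B.

Lemma mem_union s x : reflect (exists2 B, B \in s & x \in B) (x \in union s).
Proof.
rewrite /union; apply: (iffP idP) => [|[B]].
  elim: s => [|P s IHs]; first by rewrite big_nil inE.
  rewrite big_cons inE => /orP[xP|/IHs[B Bs xB]].
    by exists P; rewrite ?mem_head.
  by exists B; rewrite // in_cons Bs orbT.
move=> Bs xB; elim: s Bs => // P s IHs; rewrite in_cons big_cons inE.
by case/orP=> [/eqP <-|/IHs ->]; rewrite ?xB ?orbT.
Qed.

Lemma union_flatten ss : union (flatten ss) = union [seq union g | g <- ss].
Proof.
elim: ss => [|g ss IHss]; first by rewrite /union !big_nil.
by rewrite /union /= big_cat big_cons; congr (_ :|: _).
Qed.

Lemma ospP s : reflect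
  [/\ forall B, B \in s -> B != set0,
      pairwise (fun P Q : {set 'I_n} => [disjoint P & Q]) s & union s = setT]
  (is_osp s).
Proof.
by apply: (iffP and3P) => -[nz dj /eqP cov]; split=> //; apply/allP.
Qed.

Lemma osp_uniq s : is_osp s -> uniq s.
Proof.
case/ospP=> nz dj _; elim: s nz dj => //= B s IHs nz /andP[dB dj].
rewrite IHs ?andbT // => [|C Cs]; last by apply: nz; rewrite in_cons Cs orbT.
apply: contra (nz B (mem_head _ _)) => Bs.
by move/allP/(_ B Bs): dB; rewrite -setI_eq0 setIid.
Qed.

Lemma osp_eq s B P x : is_osp s -> B \in s -> P \in s -> x \in B -> x \in P ->
  B = P.
Proof.
case/ospP=> _ dj _; elim: s dj => //= Q s IHs /andP[/allP dQ /IHs{}IHs].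
have no_meet D : D \in s -> x \in Q -> x \in D -> False.
  by move=> /dQ /pred0P/(_ x) /= + xQ xD; rewrite xQ xD.
rewrite !in_cons => /orP[/eqP ->|Bs] /orP[/eqP ->|Ps] // xB xP; last exact: IHs.
  by case: (no_meet P).
by case: (no_meet B).
Qed.

Lemma osp_subset_eq s B P Q : is_osp s -> B != set0 -> P \in s -> Q \in s ->
  B \subset P -> B \subset Q -> P = Q.
Proof.
move=> osp_s /set0Pn[x xB] Ps Qs /subsetP/(_ x xB) xP /subsetP/(_ x xB) xQ.
exact: osp_eq osp_s Ps Qs xP xQ.
Qed.

(** A block inside a union of blocks of [s] shares a point with one of them, and
is therefore equal to it. *)
Lemma restrict_union s g : is_osp s -> {subset g <= s} ->
  restrict s (union g) = [seq B <- s | B \in g].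
Proof.
move=> osp_s g_s; apply: eq_in_filter => B Bs; apply/idP/idP => [/subsetP Bg|Bg].
  have [nz _ _] := ospP _ osp_s; have /set0Pn[x xB] := nz B Bs.
  have /mem_union[C Cg xC] := Bg x xB.
  by rewrite (osp_eq osp_s Bs (g_s _ Cg) xB xC).
by apply/subsetP => x xB; apply/mem_union; exists B.
Qed.

(** Merging a run of blocks loses nothing: the run consists of the blocks that lie
inside its union. *)
Lemma restrict_run ss g : is_osp (flatten ss) -> g \in ss ->
  restrict (flatten ss) (union g) = g.
Proof.
move=> osp_ss g_ss; rewrite restrict_union // => [|B Bg]; last first.
  by apply/flattenP; exists g.
have := osp_uniq osp_ss; case/splitPr: g_ss {osp_ss} => ss1 ss2.
rewrite flatten_cat /= => uniq_ss.
have drop_run h : ~~ has (mem g) h -> [seq B <- h | B \in g] = [::].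
  by rewrite has_filter negbK => /eqP.
move: uniq_ss; rewrite uniq_catCA !cat_uniq has_cat negb_or.
case/and3P=> _ /andP[g1 g2] _.
rewrite !filter_cat (drop_run _ g1) (drop_run _ g2) cats0.
by apply/all_filterP/allP.
Qed.

Lemma is_osp_merge ss : is_osp (flatten ss) -> [::] \notin ss ->
  is_osp [seq union g | g <- ss].
Proof.
case/ospP=> nz dj cov ss0; apply/ospP; split; last by rewrite -cov -union_flatten.
  move=> _ /mapP[[|B g] g_ss ->]; first by rewrite g_ss in ss0.
  have /set0Pn[x xB]: B != set0.
    by apply: nz; apply/flattenP; exists (B :: g); rewrite ?mem_head.
  by apply/set0Pn; exists x; apply/mem_union; exists B; rewrite ?mem_head.
elim: ss dj {nz cov ss0} => //= g ss IHss.
rewrite pairwise_cat => /and3P[/allrelP g_ss _ /IHss ->]; rewrite andbT.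
apply/allP => _ /mapP[h h_ss ->]; apply/pred0P => x /=; apply/negP => /andP[].
case/mem_union=> B Bg xB /mem_union[C Ch xC].
have /pred0P/(_ x)/= : [disjoint B & C].
  by apply: g_ss => //; apply/flattenP; exists h.
by rewrite xB xC.
Qed.

Lemma size_restrict (s : OP n) P : size (restrict s P) = nblocks_in s P.
Proof. exact: size_filter. Qed.

(** The form of the order used everywhere below.  Send each block of [s] to the
index of the block of [r] containing it.  The order condition says that this
index is nondecreasing along [s], that is, that grouping the blocks of [s] by
index, in increasing order of the index, gives back [s]. *)
Lemma ople_flatten (s r : OP n) :
  ople s r = (flatten [seq restrict s Q | Q <- blocks r] == blocks s).
Proof.
have osp_s : is_osp s := valP s; have osp_r : is_osp r := valP r.
have [nz_s _ _] := ospP _ osp_s.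
apply/idP/eqP => [/andP[ref_sr ord_sr] | eq_s].
  pose f (B : {set 'I_n}) := find (fun Q : {set 'I_n} => B \subset Q) r.
  have has_sr B : B \in blocks s -> has (fun Q : {set 'I_n} => B \subset Q) r.
    move=> Bs; move/forallP/(_ B)/implyP: ref_sr; rewrite inE => /(_ Bs).
    by case/exists_inP=> Q; rewrite inE => Qr BQ; apply/hasP; exists Q.
  have f_lt B : B \in blocks s -> (f B < size r)%N.
    by rewrite -has_find; apply: has_sr.
  have f_sub B : B \in blocks s -> B \subset nth set0 r (f B).
    by move=> /has_sr/(nth_find set0).
  have f_eq B k : B \in blocks s -> (k < size r)%N ->
      (B \subset nth set0 r k) = (f B == k).
    move=> Bs k_lt; apply/idP/eqP => [Bk|<-]; last exact: f_sub.
    apply/eqP; rewrite -(nth_uniq set0 (f_lt B Bs) k_lt (osp_uniq osp_r)).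
    apply/eqP; apply: osp_subset_eq osp_r (nz_s B Bs) _ _ (f_sub B Bs) Bk.
      exact/mem_nth/f_lt.
    exact: mem_nth.
  rewrite -[in LHS](mkseq_nth set0 r) -map_comp.
  rewrite -[RHS](@flatten_fibers _ f _ (size r)); last exact/allP.
    congr flatten; apply/eq_in_map => k; rewrite mem_iota => /= k_lt.
    by apply: eq_in_filter => B Bs; rewrite f_eq.
  apply/(pairwiseP set0) => i j; rewrite !inE => i_lt j_lt ij.
  have Bi := mem_nth set0 i_lt; have Bj := mem_nth set0 j_lt.
  move/forallP/(_ (Ordinal i_lt))/forallP/(_ (Ordinal j_lt)): ord_sr.
  move/forallP/(_ (Ordinal (f_lt _ Bi)))/forallP/(_ (Ordinal (f_lt _ Bj))).
  by move/implyP; apply; rewrite /= ij !f_sub.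
have mem_s B : B \in blocks s -> exists2 Q, Q \in blocks r & B \subset Q.
  rewrite -eq_s => /flatten_mapP[Q Qr]; rewrite mem_filter => /andP[BQ _].
  by exists Q.
apply/andP; split.
  apply/forall_inP => B; rewrite inE => /mem_s[Q Qr BQ].
  by apply/exists_inP; exists Q; rewrite ?inE.
apply/forallP => i; apply/forallP => j; apply/forallP => k; apply/forallP => l.
apply/implyP => /and3P[ij sik sjl]; rewrite leqNgt; apply/negP => lk.
have eq_r : blocks r = take k r ++ drop k r by rewrite cat_take_drop.
move: eq_s; rewrite [in LHS]eq_r map_cat flatten_cat.
(* [s_j] occurs before the runs from index [k] on, and [s_i] among them. *)
set s1 := flatten _; set s2 := flatten _ => eq_s.
have uniq_s := osp_uniq osp_s.
have s1j : block j \in s1.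
  apply/flatten_mapP; exists (block l); last by rewrite mem_filter sjl mem_nth.
  by rewrite /block -(nth_take _ lk) mem_nth // size_take ltn_ord.
have s2i : block i \in s2.
  apply/flatten_mapP; exists (block k); last by rewrite mem_filter sik mem_nth.
  by rewrite /block -[k in nth _ _ k]addn0 -nth_drop mem_nth // size_drop subn_gt0.
have: (index (block j) (blocks s) < index (block i) (blocks s))%N.
  rewrite -eq_s !index_cat s1j; case: ifP => [s1i|_]; last first.
    by rewrite ltn_addr // index_mem.
  move: uniq_s; rewrite -eq_s cat_uniq => /and3P[_ /hasP[]].
  by exists (block i).
by rewrite !index_uniq // ltnNge ltnW.
Qed.

End OrderedPartitions.

(** * Intervals as products of sets of compositions *)

Fixpoint composition_families (ks : seq nat) : seq (seq (seq nat)) :=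
  if ks is k :: ks'
  then [seq c :: cs | c <- compositions k, cs <- composition_families ks']
  else [:: [::]].

Lemma uniq_composition_families ks : uniq (composition_families ks).
Proof.
elim: ks => //= k ks IHks; apply: allpairs_uniq => //.
  exact: uniq_compositions.
by move=> [c cs] [d ds] _ _ /= [-> ->].
Qed.

Lemma map_composition_family (T : eqType) (p : seq T) (k : T -> nat) c :
  {in p, forall P, c P \in compositions (k P)} ->
  map c p \in composition_families (map k p).
Proof.
elim: p => //= P p IHp cP; apply: allpairs_f; first exact/cP/mem_head.
by apply: IHp => Q Qp; apply: cP; rewrite in_cons Qp orbT.
Qed.

Lemma composition_familyP (T : eqType) (p : seq T) (k : T -> nat) cs :
  uniq p -> cs \in composition_families (map k p) ->
  exists2 c, {in p, forall P, c P \in compositions (k P)} & cs = map c p.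
Proof.
elim: p cs => [|P p IHp] cs /=.
  by rewrite inE => _ /eqP ->; exists (fun=> [::]).
case/andP=> Pp /IHp{}IHp /allpairsP[[d ds] [/= d_k /IHp[c c_k ->] ->]].
exists (fun Q => if Q == P then d else c Q) => [Q|].
  by rewrite in_cons; case: eqP => [-> //|_ /=]; apply: c_k.
rewrite eqxx; congr (_ :: _); apply/eq_in_map => Q Qp.
by case: eqP Pp => // <-; rewrite Qp.
Qed.

Lemma sum_composition_families (K : comNzRingType) ks (w : nat -> seq nat -> K) :
  \sum_(cs <- composition_families ks)
     \prod_(i < size ks) w i (nth [::] cs i) =
  \prod_(i < size ks) \sum_(c <- compositions (nth 0%N ks i)) w i c.
Proof.
elim: ks w => [|k ks IHks] w /=; first by rewrite big_seq1 !big_ord0.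
rewrite big_allpairs_dep /= big_ord_recl -(IHks (fun i => w i.+1)) big_distrl /=.
apply: eq_bigr => c _; rewrite big_distrr; apply: eq_bigr => cs _.
by rewrite big_ord_recl.
Qed.

Lemma flatten_map_filter (S T : Type) (a : pred S) (f : S -> seq T) (l : seq S) :
  flatten [seq f x | x <- l & a x] =
  flatten [seq (if a x then f x else [::]) | x <- l].
Proof. by elim: l => //= x l <-; case: ifP. Qed.

Section Intervals.
Variable n : nat.
Implicit Types (s r p : OP n) (B P Q : {set 'I_n}).

Lemma block_neq0 s B : B \in blocks s -> B != set0.
Proof. by case/ospP: (valP s) => nz _ _; apply: nz. Qed.

Lemma ople_concat s r : ople s r ->
  flatten [seq restrict s Q | Q <- blocks r] = blocks s.
Proof. by rewrite ople_flatten => /eqP. Qed.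

Lemma ople_sub s r B : ople s r -> B \in blocks s ->
  exists2 Q, Q \in blocks r & B \subset Q.
Proof.
move=> sr; rewrite -(ople_concat sr) => /flatten_mapP[Q Qr].
by rewrite mem_filter => /andP[BQ _]; exists Q.
Qed.

Lemma union_restrict s r Q : ople s r -> Q \in blocks r ->
  union (restrict s Q) = Q.
Proof.
move=> sr Qr; apply/setP => x; apply/mem_union/idP => [[B]|xQ].
  by rewrite mem_filter => /andP[/subsetP BQ _] /BQ.
have [_ _ cov] := ospP _ (valP s).
have /mem_union[B Bs xB] : x \in union s by rewrite cov inE.
have [Q' Q'r BQ'] := ople_sub sr Bs.
exists B; rewrite // mem_filter Bs andbT.
by rewrite (osp_eq (valP r) Qr Q'r xQ (subsetP BQ' x xB)).
Qed.

Lemma nblocks_in_gt0 s r Q : ople s r -> Q \in blocks r -> (0 < nblocks_in s Q)%N.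
Proof.
move=> sr Qr; rewrite -size_restrict lt0n size_eq0.
apply: contra (block_neq0 Qr) => /eqP sQ0.
by rewrite -(union_restrict sr Qr) sQ0 /union big_nil.
Qed.

Lemma restrict_restrict s r p P : ople s r -> ople r p -> P \in blocks p ->
  flatten [seq restrict s Q | Q <- restrict r P] = restrict s P.
Proof.
move=> sr rp Pp; rewrite flatten_map_filter /restrict.
rewrite -[in RHS](ople_concat sr) filter_flatten -map_comp.
congr flatten; apply/eq_in_map => Q Qr /=; case: ifPn => [QP|QnP].
  apply/esym/all_filterP/allP => B; rewrite mem_filter => /andP[BQ _].
  exact: subset_trans QP.
apply/esym/eqP; rewrite -[_ == _]negbK -has_filter; apply/hasP => -[B].
rewrite mem_filter => /andP[BQ Bs] BP; case/negP: QnP.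
have [P' P'p QP'] := ople_sub rp Qr.
by rewrite (osp_subset_eq (valP p) (block_neq0 Bs) Pp P'p BP (subset_trans BQ QP')).
Qed.

(** For [r] between [s] and [p], the sequence of compositions that tells, for each
block of [p], how the blocks of [s] inside it are grouped by [r]. *)
Definition profile s p r : seq (seq nat) :=
  [seq [seq nblocks_in s Q | Q <- restrict r P] | P <- blocks p].

(** Cutting the run of blocks of [s] inside [P] according to the composition
given by [r], then merging, recovers the blocks of [r] inside [P]. *)
Lemma restrict_reshape s r p P : ople s r -> ople r p -> P \in blocks p ->
  restrict r P =
  [seq union g | g <- reshape [seq nblocks_in s Q | Q <- restrict r P]
                              (restrict s P)].
Proof.
move=> sr rp Pp; rewrite -(restrict_restrict sr rp Pp).
have -> : [seq nblocks_in s Q | Q <- restrict r P] =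
          shape [seq restrict s Q | Q <- restrict r P].
  by rewrite /shape -map_comp; apply: eq_map => Q /=; rewrite size_restrict.
rewrite flattenK -map_comp -[LHS]map_id; apply/eq_in_map => Q.
by rewrite mem_filter => /andP[_ /(union_restrict sr)].
Qed.

Lemma profile_inj s p r r' : ople s r -> ople r p -> ople s r' -> ople r' p ->
  profile s p r = profile s p r' -> r = r'.
Proof.
move=> sr rp sr' r'p /eq_in_map eq_prof; apply/val_inj => /=.
rewrite -(ople_concat rp) -(ople_concat r'p); congr flatten.
apply/eq_in_map => P Pp; rewrite (restrict_reshape sr rp Pp).
by rewrite (restrict_reshape sr' r'p Pp) eq_prof.
Qed.

Lemma profile_composition_family s p r : ople s r -> ople r p ->
  profile s p r \in composition_families [seq nblocks_in s P | P <- blocks p].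
Proof.
move=> sr rp; apply: map_composition_family => P Pp.
rewrite mem_compositions; apply/andP; split.
  apply/mapP => -[Q]; rewrite mem_filter => /andP[_ /(nblocks_in_gt0 sr)].
  by case: nblocks_in.
rewrite -size_restrict -(restrict_restrict sr rp Pp) size_flatten /shape -map_comp.
by apply/eqP; congr sumn; apply: eq_map => Q /=; rewrite size_restrict.
Qed.

(** Cut the run of each block of [p] into the prescribed lengths and merge the
pieces; by [restrict_run], restricting to the merged blocks gives the pieces
back, which yields both inequalities and the profile. *)
Lemma profile_surj s p cs : ople s p ->
  cs \in composition_families [seq nblocks_in s P | P <- blocks p] ->
  exists r, [/\ ople s r, ople r p & profile s p r = cs].
Proof.
move=> sp /(composition_familyP (osp_uniq (valP p)))[c c_comp ->].
pose runs P := reshape (c P) (restrict s P).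
pose merged P := [seq union g | g <- runs P].
have cE P : P \in blocks p ->
    0%N \notin c P /\ sumn (c P) = size (restrict s P).
  by move=> /c_comp; rewrite mem_compositions size_restrict => /andP[? /eqP].
have runsK P : P \in blocks p -> flatten (runs P) = restrict s P.
  by move=> /cE[_ cP]; rewrite reshapeKr // cP.
have shape_runs P : P \in blocks p -> shape (runs P) = c P.
  by move=> /cE[_ cP]; rewrite reshapeKl // cP.
pose ss := flatten [seq runs P | P <- blocks p].
have ssK : flatten ss = blocks s.
  rewrite -[RHS](ople_concat sp) /ss.
  transitivity (flatten [seq flatten (runs P) | P <- blocks p]).
    by elim: (blocks p) => //= P l IHl; rewrite flatten_cat IHl.
  by congr flatten; apply/eq_in_map.
have osp_ss : is_osp (flatten ss) by rewrite ssK; apply: (valP s).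
have ss0 : [::] \notin ss.
  apply/negP => /flatten_mapP[P Pp run0]; have [/negP[]] := cE P Pp.
  by rewrite -shape_runs //; apply/mapP; exists [::].
have r_ss : [seq union g | g <- ss] = flatten [seq merged P | P <- blocks p].
  by rewrite map_flatten -map_comp.
have osp_r := is_osp_merge osp_ss ss0; pose r := Osp osp_r; exists r.
have restrict_s g : g \in ss -> restrict s (union g) = g.
  by move=> g_ss; rewrite -ssK restrict_run.
have restrict_r P : P \in blocks p -> restrict r P = merged P.
  move=> Pp; rewrite -[P in restrict _ P](union_restrict sp Pp) -runsK //.
  rewrite union_flatten /= r_ss restrict_run -?r_ss //.
  exact: map_f.
split.
- rewrite ople_flatten -[X in _ == X]ssK -map_comp; apply/eqP; congr flatten.
  by rewrite -[RHS]map_id; apply/eq_in_map.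
- rewrite ople_flatten [X in _ == X]r_ss; apply/eqP; congr flatten.
  exact/eq_in_map.
apply/eq_in_map => P Pp; rewrite restrict_r // -map_comp -shape_runs //.
apply/eq_in_map => g g_run /=; rewrite -size_restrict restrict_s //.
by apply/flatten_mapP; exists P.
Qed.

Lemma perm_profiles s p : ople s p ->
  perm_eq [seq profile s p r | r : Defs.interval s p <- index_enum _]
          (composition_families [seq nblocks_in s P | P <- blocks p]).
Proof.
move=> sp; apply: uniq_perm.
- rewrite map_inj_in_uniq ?index_enum_uniq // => r r' _ _ eq_prof.
  apply: val_inj; apply: profile_inj eq_prof;
    by [apply: interval_l | apply: interval_r].
- exact: uniq_composition_families.
move=> cs; apply/mapP/idP => [[r _ ->]|/(profile_surj sp)[r [sr rp <-]]].
  by apply: profile_composition_family; [apply: interval_l | apply: interval_r].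
have srp : ople s r && ople r p by rewrite sr.
by exists (Defs.Interval srp); rewrite ?mem_index_enum.
Qed.

(** The summand depends on [r] through its profile only, and a sum over families
of compositions of a product of local factors is the product of the local
sums. *)
Lemma interval_sum (K : comNzRingType) s p (a b : nat -> nat -> K) : ople s p ->
  \sum_(r : Defs.interval s p)
     (\prod_(i < size p) \prod_(B <- blocks r | B \subset block i)
        a i (nblocks_in s B)) *
     \prod_(i < size p) b i (nblocks_in r (block i)) =
  \prod_(i < size p) composition_sum (a i) (b i) (nblocks_in s (block i)).
Proof.
move=> sp; pose w i c := (\prod_(j <- c) a i j) * b i (size c).
pose ks := [seq nblocks_in s P | P <- blocks p].
have size_ks : size ks = size p by rewrite size_map.
transitivity (\sum_(cs <- composition_families ks)
                \prod_(i < size ks) w i (nth [::] cs i)).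
  rewrite -(perm_big _ (perm_profiles sp)) big_map size_ks; apply: eq_bigr => r _.
  rewrite -big_split; apply: eq_bigr => i _ /=.
  by rewrite (nth_map set0) // /w size_map size_restrict big_map big_filter.
rewrite sum_composition_families size_ks; apply: eq_bigr => i _.
by rewrite (nth_map set0).
Qed.

End Intervals.

(** * Multiplicative functions on intervals *)

Section IntervalFunctions.
Variable n : nat.
Implicit Types (s r p : OP n).

Lemma prod_blocks (K : comNzRingType) p (f : {set 'I_n} -> K) :
  \prod_(P <- blocks p) f P = \prod_(i < size p) f (block i).
Proof. by rewrite (big_nth set0) big_mkord. Qed.

Lemma prod_blocks_nested (K : comNzRingType) r p (f : {set 'I_n} -> K) :
  ople r p ->
  \prod_(Q <- blocks r) f Q =
  \prod_(i < size p) \prod_(Q <- blocks r | Q \subset block i) f Q.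
Proof.
move=> rp; rewrite -[in LHS](ople_concat rp) big_flatten big_map prod_blocks.
by apply: eq_bigr => i _; rewrite big_filter.
Qed.

(** The number of blocks of [s] is the sum over the blocks of [p] of the numbers
of blocks inside them, all positive, so the exponent splits. *)
Lemma sign_size_sub (K : comNzRingType) s p : ople s p ->
  (-1) ^+ (size s - size p) =
  \prod_(P <- blocks p) (-1) ^+ (nblocks_in s P).-1 :> K.
Proof.
move=> sp; rewrite -(big_morph _ (exprD (-1)) (expr0 (-1))); congr (_ ^+ _).
have -> : size s = \sum_(P <- blocks p) ((nblocks_in s P).-1 + 1)%N.
  rewrite -[blocks s](ople_concat sp) size_flatten /shape -map_comp sumnE big_map.
  apply: eq_big_seq => P Pp /=; rewrite size_restrict addn1 prednK //.
  exact: nblocks_in_gt0 sp Pp.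
by rewrite big_split /= sum1_size addnK.
Qed.

(** If each block of [p] contains a single block of [s], it is equal to it, being
the union of the blocks of [s] that it contains. *)
Lemma all_nblocks1 s p : ople s p ->
  [forall i : 'I_(size p), nblocks_in s (block i) == 1%N] = (s == p).
Proof.
move=> sp; apply/forallP/eqP => [s1|-> i].
  apply/val_inj => /=; rewrite -(ople_concat sp) -[RHS]flatten_seq1.
  congr flatten; apply/eq_in_map => P Pp.
  have /eqP := s1 (Ordinal (etrans (index_mem P (blocks p)) Pp)).
  rewrite /block nth_index // -size_restrict.
  have := union_restrict sp Pp; case: restrict => [|B [|]] //.
  by rewrite /union big_seq1 => ->.
have p_runs : flatten [seq [:: P] | P <- blocks p] = p by rewrite flatten_seq1.
have -> : block i = union [:: block i] by rewrite /union big_seq1.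
rewrite -size_restrict -[X in restrict X _]p_runs.
rewrite restrict_run ?p_runs ?(valP p) //; apply/mapP.
by exists (block i); rewrite // mem_nth.
Qed.

(** This is why the coefficient sequence of X, the unit for composition of series,
gives the unit for convolution. *)
Lemma prod_nblocks1 (K : comNzRingType) s p : ople s p ->
  \prod_(i < size p) (nblocks_in s (block i) == 1%N)%:R = (s == p)%:R :> K.
Proof.
move=> /all_nblocks1 <-; case: forallP => [s1|/forallP].
  by rewrite big1 // => i _; rewrite s1.
by rewrite negb_forall => /existsP[i /negbTE si]; rewrite (bigD1 i) //= si mul0r.
Qed.

End IntervalFunctions.

Section ComplexValued.
Variable R : realType.
Local Notation C := R[i]%C.

Lemma binr_complex (x : R) k : (binr x k)%:C%C = gbin (x%:C)%C k :> C.
Proof.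
rewrite /binr rmorphM fmorphV rmorph_nat rmorph_prod; congr (_ / _).
by apply: eq_bigr => i _; rewrite rmorphB rmorph_nat.
Qed.

Lemma mu_prod n (s p : OP n.+1) (sp : ople s p) :
  mu n s p sp = \prod_(P <- blocks p) log_coef C (nblocks_in s P).
Proof. by rewrite /mu (sign_size_sub _ sp) big_split /= prodfV. Qed.

Lemma zeta_prod n (s p : OP n.+1) (sp : ople s p) :
  zeta n s p sp = \prod_(P <- blocks p) exp_coef C (nblocks_in s P).
Proof. by rewrite /zeta prodfV. Qed.

Lemma conv_blockwise (a b : nat -> C) (f g : F2 R) :
  (forall n (s p : OP n.+1) (sp : ople s p),
     f n s p sp = \prod_(P <- blocks p) a (nblocks_in s P)) ->
  (forall n (s p : OP n.+1) (sp : ople s p),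
     g n s p sp = \prod_(P <- blocks p) b (nblocks_in s P)) ->
  forall n (s p : OP n.+1) (sp : ople s p),
    conv f g sp =
    \prod_(i < size p) composition_sum a b (nblocks_in s (block i)).
Proof.
move=> fE gE n s p sp; rewrite -(interval_sum (fun=> a) (fun=> b) sp).
apply: eq_bigr => r _.
by rewrite fE gE (prod_blocks_nested _ (interval_r r)) prod_blocks.
Qed.

Lemma F2_ext (f g : F2 R) :
  (forall n (s p : OP n.+1) (sp : ople s p), f n s p sp = g n s p sp) -> f = g.
Proof.
move=> fg; apply: functional_extensionality_dep => n.
do 3 (apply: functional_extensionality_dep => ?); exact: fg.
Qed.

Lemma block_gt0 n (s p : OP n) (sp : ople s p) (i : 'I_(size p)) :
  (0 < nblocks_in s (block i))%N.
Proof. by apply: nblocks_in_gt0 sp _; apply: mem_nth. Qed.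

Lemma conv_mu_zeta : conv (@mu R) (@zeta R) = @delta R.
Proof.
apply: F2_ext => n s p sp; rewrite (conv_blockwise mu_prod zeta_prod) /delta.
rewrite -(prod_nblocks1 _ sp); apply: eq_bigr => i _.
by rewrite composition_sum_log_exp ?(block_gt0 sp).
Qed.

Lemma conv_zeta_mu : conv (@zeta R) (@mu R) = @delta R.
Proof.
apply: F2_ext => n s p sp; rewrite (conv_blockwise zeta_prod mu_prod) /delta.
rewrite -(prod_nblocks1 _ sp); apply: eq_bigr => i _.
by rewrite composition_sum_exp_log ?(block_gt0 sp).
Qed.

Lemma triangle_gamma_beta (s t : nat -> R) :
  triangle (gamma s) (beta t) = beta (fun i => s i * t i).
Proof.
apply: F2_ext => n sg p sp.
pose binC (u : nat -> R) i k := ((binr (u i) k)%:C)%C.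
rewrite /triangle /gamma /beta (interval_sum (binC s) (binC t) sp).
apply: eq_bigr => i _; have k_gt0 := block_gt0 sp i.
rewrite binr_complex rmorphM -composition_sum_gbin //.
by apply: eq_composition_sum => // j _; rewrite /binC binr_complex.
Qed.

Lemma conv_beta_const (s t : R) :
  conv (beta_const s) (beta_const t) = beta_const (s * t).
Proof.
rewrite -[RHS](triangle_gamma_beta (fun=> s) (fun=> t)).
apply: F2_ext => n sg p sp; apply: eq_bigr => r _; congr (_ * _).
by rewrite /gamma -prod_blocks_nested ?(interval_r r) // prod_blocks.
Qed.

End ComplexValued.

Theorem corollaryA32 (R : realType) :
  [/\ conv (@mu R) (@zeta R) = @delta R /\ conv (@zeta R) (@mu R) = @delta R,
      forall s t : nat -> R,
        triangle (gamma s) (beta t) = beta (fun i => s i * t i)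
    & forall s t : R,
        conv (beta_const s) (beta_const t) = beta_const (s * t)].
Proof.
split; first by split; [apply: conv_mu_zeta | apply: conv_zeta_mu].
  exact: triangle_gamma_beta.
exact: conv_beta_const.
Qed.
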